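(* For all positive integers $k$ and $\ell$, \[ R_k(C_{2\ell+1}) \le (4\ell - 2)^k \cdot k^{k/\ell} + 1, \] where $C_{2\ell+1}$ denotes the cycle of length $2\ell+1$.
   Context: The $k$-colour Ramsey number $R_k(H)$ of a graph $H$ is the smallest integer $n$ such that every colouring of the edges of the complete graph $K_n$ with $k$ colours contains a monochromatic copy of $H$ (a copy of $H$ all of whose edges have the same colour). *)

(* Defs.v *)
From mathcomp Require Import all_boot all_order all_algebra.
From mathcomp Require Import reals exp.

Set Implicit Arguments.
Unset Strict Implicit.
Unset Printing Implicit Defensive.

Record sgraph := SGraph {
  vertex : finType;
  adj : rel vertex;
  adj_sym : symmetric adj;
  adj_irr : irreflexive adj
}.

(* The conjunct [x != y] only matters for m = 1, where it removes the loop;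
   for m >= 3 this is the cycle of length m. *)
Definition cycle_adj (m : nat) : rel 'I_m :=
  fun x y => (x != y) && ((y == ordS x) || (x == ordS y)).

Lemma cycle_adj_sym m : symmetric (@cycle_adj m).
Proof. by move=> x y; rewrite /cycle_adj eq_sym orbC. Qed.

Lemma cycle_adj_irr m : irreflexive (@cycle_adj m).
Proof. by move=> x; rewrite /cycle_adj eqxx. Qed.

Definition cycle_graph (m : nat) : sgraph :=
  SGraph (@cycle_adj_sym m) (@cycle_adj_irr m).

Definition complete_edge (n : nat) : finType :=
  {e : {set 'I_n} | #|e| == 2}.

Definition edge_colouring (n k : nat) : finType :=
  {ffun complete_edge n -> 'I_k}.

Definition colour_class n k (c : edge_colouring n k) (i : 'I_k) : rel 'I_n :=
  fun x y => [exists e : complete_edge n,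
    (val e == [set x; y]) && (c e == i)].

(* Copies are not required to be induced. *)
Definition mono_copy n k (c : edge_colouring n k) (H : sgraph) (i : 'I_k)
    (f : {ffun vertex H -> 'I_n}) : bool :=
  injectiveb f &&
  [forall x, forall y, adj x y ==> colour_class c i (f x) (f y)].

Definition arrows (k : nat) (H : sgraph) (n : nat) : bool :=
  [forall c : edge_colouring n k,
    [exists i : 'I_k, [exists f : {ffun vertex H -> 'I_n}, mono_copy c i f]]].

Lemma ramsey_sets k (s : 'I_k -> nat) :
  exists N, forall (T : finType) (e : 'I_k -> rel T) (S : {set T}),
    (forall i, symmetric (e i)) ->
    (forall x y, x != y -> exists i, e i x y) ->
    N <= #|S| ->
    exists i (A : {set T}), #|A| = s i /\
      {in A &, forall x y, x != y -> e i x y}.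
Proof.
move: {2}(\sum_i s i) (leqnn (\sum_i s i)) => m.
elim: m s => [|m IH] s les.
all: case: (pickP (fun i => s i == 0)) => [i /eqP si0|s_gt0].
1,3: exists 0 => T e S _ _ _; exists i, set0; rewrite cards0; split=> //.
1,2: by move=> x y; rewrite inE.
- exists 2 => T e S _ ecov /card_gt1P[x [y [_ _ xy]]].
  have [i _] := ecov _ _ xy.
  by move: les; rewrite (bigD1 i) //= leqn0 addn_eq0 s_gt0.
pose s' i j := if j == i then (s j).-1 else s j.
have les' i : \sum_j s' i j <= m.
  rewrite -ltnS; apply: leq_trans les; rewrite (bigD1 i) //= [X in _ < X](bigD1 i) //=.
  rewrite /s' eqxx -addSn prednK ?lt0n ?s_gt0 // leq_add2l.
  by apply: leq_sum => j /negPf ->.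
have [N HN] := fin_all_exists (fun i => IH _ (les' i)).
exists (\sum_i N i).+2 => T e S esym ecov leS.
have /card_gt0P[x xS] : 0 < #|S| by apply: leq_trans leS.
pose B i := [set y in S :\ x | e i x y].
have SB : S :\ x \subset \bigcup_i B i.
  apply/subsetP => y yS; have /setD1P[yx _] := yS.
  rewrite eq_sym in yx; have [i exy] := ecov _ _ yx.
  by apply/bigcupP; exists i => //; rewrite inE yS.
have [i leB] : exists i, N i <= #|B i|.
  case: (pickP (fun i => N i <= #|B i|)) => [i Hi|no]; first by exists i.
  have : \sum_i N i < #|\bigcup_i B i|.
    apply: leq_trans (subset_leq_card SB).
    by move: leS; rewrite (cardsD1 x) xS add1n ltnS.
  have ->// : (\sum_i N i < #|\bigcup_i B i|) = false.
  apply/negbTE; rewrite -leqNgt.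
  apply: (@leq_trans (\sum_i #|B i|)).
    elim/big_rec2: _ => [|i a b _ ab]; first by rewrite cards0.
    by apply: leq_trans (leq_card_setU _ _) _; rewrite leq_add2l.
  by apply: leq_sum => i _; move: (no i) => /negbT; rewrite -ltnNge => /ltnW.
have [j [A [cA mA]]] := HN i _ (fun j (u v : {y | y \in B i}) => e j (val u) (val v))
  [set: _] (fun j u v => esym j _ _)
  (fun u v uv => ecov _ _ (uv : val u != val v))
  ltac:(by rewrite cardsT card_sig).
pose A' := val @: A.
have cA' : #|A'| = s' i j by rewrite card_imset //; apply: val_inj.
have mA' : {in A' &, forall y z, y != z -> e j y z}.
  by move=> _ _ /imsetP[u uA ->] /imsetP[v vA ->] uv; apply: mA.
have AB y : y \in A' -> y \in B i by case/imsetP=> u _ ->; apply: valP.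
move: cA' mA'; rewrite /s'; have [-> cA' mA'|_ cA' mA'] := eqVneq j i; last first.
  by exists j, A'.
exists i, (x |: A'); split.
  rewrite cardsU1 cA'.
  have -> : x \notin A' by apply/negP => /AB; rewrite !inE eqxx.
  by rewrite add1n prednK // lt0n s_gt0.
move=> y z /setU1P[->|yA] /setU1P[->|zA].
- by rewrite eqxx.
- by move=> _; move: (AB _ zA); rewrite inE => /andP[].
- by move=> _; rewrite esym; move: (AB _ yA); rewrite inE => /andP[].
- exact: mA'.
Qed.

Lemma ramsey_exists (k : nat) (H : sgraph) : exists n, arrows k H n.
Proof.
have [n Hn] := ramsey_sets (fun _ : 'I_k => #|vertex H|).
exists n; apply/forallP => c.
have csym i : symmetric (colour_class c i).
  by move=> x y; rewrite /colour_class setUC.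
have ccov x y : x != y -> exists i, colour_class c i x y.
  move=> xy; have xy2 : #|[set x; y]| == 2 by rewrite cards2 xy.
  exists (c (Sub [set x; y] xy2)); apply/existsP; exists (Sub [set x; y] xy2).
  by rewrite SubK !eqxx.
have leT : n <= #|[set: 'I_n]| by rewrite cardsT card_ord.
have [i [A [cA mA]]] := Hn _ _ _ csym ccov leT.
have cH : #|vertex H| = #|A| by rewrite cA.
pose g v := enum_val (cast_ord cH (enum_rank v)).
have ginj : injective g.
  by move=> u v /enum_val_inj /cast_ord_inj /enum_rank_inj.
apply/existsP; exists i; apply/existsP; exists [ffun v => g v].
apply/andP; split.
  by apply/injectiveP => u v; rewrite !ffunE => /ginj.
apply/forallP => u; apply/forallP => v; apply/implyP => uv; rewrite !ffunE.
apply: mA; rewrite ?enum_valP //; apply: contraTneq uv => /ginj ->.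
by rewrite adj_irr.
Qed.

Definition ramsey_number (k : nat) (H : sgraph) : nat :=
  ex_minn (ramsey_exists k H).

(* Main.v *)
(* A set W of vertices is maintained together with, for every x in W, the set
   A x of colours still active at x, such that an edge of colour i inside W has
   i active at both ends.  The potential is the sum over W of q^|A x|, where
   q = 1 / ((4l-2) c) and c = k^(1/l).  Take v in W with A v nonempty.  The
   closed neighbourhoods of v in the colours of A v cover W, so in some colour i
   the ball of radius 1 has at least a fraction 1/k = c^(-l) of the potential;
   hence for some 1 <= j <= l the ball B of radius j carries at least a fraction
   1/c of the potential of a set S (the ball of radius j+1, or all of W if
   j = l) containing B and its i-neighbours.  Without an odd cycle of length
   2l+1 in colour i, every sphere of radius at most l is (2l-1)-colourable, so B
   is (4l-2)-colourable and contains an i-independent subset I with a fraction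
   1/(4l-2) of its potential.  Replacing S by I and deactivating i on I does not
   decrease the potential.  Once no colour is active, |W| <= 1, so the potential
   is at most 1 throughout; initially it is n q^k.

   The bound on the chromatic number of a sphere is due to Erdos, Faudree,
   Rousseau and Schelp.  Order the sphere lexicographically along a BFS tree; if
   it is not (2l-1)-colourable it has an increasing path on 2l vertices.  Let M
   be the largest height of a lowest common ancestor of two consecutive vertices
   of this path.  Any window of 2l+1-2M edges of the path around such a pair has
   ends whose lowest common ancestor has height exactly M, and so closes up
   through the tree to a cycle of length 2l+1. *)

Require Import Defs.
From mathcomp Require Import all_boot all_order all_algebra.
From mathcomp Require Import reals exp.
From mathcomp Require Import zify.

Set Implicit Arguments.
Unset Strict Implicit.
Unset Printing Implicit Defensive.

Import Order.TTheory GRing.Theory Num.Theory.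
Local Open Scope ring_scope.

(* A cycle of length m+1, as the sequence g 0, ..., g m. *)
Definition has_cycle (T : Type) (e : rel T) (m : nat) : Prop :=
  exists g : nat -> T, [/\ {in gtn m.+1 &, injective g},
    (forall q, (q < m)%N -> e (g q) (g q.+1)) & e (g m) (g 0%N)].

(** * Colouring a single layer of a rooted tree without an odd cycle *)

Section Layers.
Local Open Scope nat_scope.

Variables (T : finType) (e : rel T) (l : nat).
Hypotheses (e_sym : symmetric e) (no_cycle : ~ has_cycle e (2 * l)).
Hypothesis l_gt0 : 0 < l.

Variables (d : T -> nat) (par : T -> T).
Hypothesis root_uniq : forall x y, d x = 0 -> d y = 0 -> x = y.
Hypothesis par_depth : forall x, 0 < d x <= l -> d (par x) = (d x).-1.
Hypothesis par_edge : forall x, 0 < d x <= l -> e x (par x).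

Lemma iter_par_depth t x : t <= d x <= l -> d (iter t par x) = d x - t.
Proof.
elim: t => [|t IH] tx /=; first by rewrite subn0.
have Ht : d (iter t par x) = d x - t by apply: IH; lia.
by rewrite par_depth Ht; lia.
Qed.

Lemma iter_par_edge t x :
  t < d x <= l -> e (iter t par x) (iter t.+1 par x).
Proof. by move=> tx; apply: par_edge; rewrite iter_par_depth; lia. Qed.

(* Comparing keys of depth j compares, lexicographically from the root down,
   the chains of ancestors, so that the descendants of any vertex form an
   interval. *)
Fixpoint key (j : nat) (x : T) : nat :=
  if j is j'.+1 then key j' (par x) * #|T| + enum_rank x else enum_rank x.

Lemma key_inj j : injective (key j).
Proof.
case: j => [|j] x y /=; first by move/val_inj/enum_rank_inj.
move/(congr1 (modn^~ #|T|)); rewrite !modnMDl !modn_small //.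
by move/val_inj/enum_rank_inj.
Qed.

(** In base [#|T|] the digits of [key j x] are the ranks of [x] and its ancestors, so deleting the
    last [t] digits passes to the [t]-th ancestor. *)
Lemma key_iter_par j t x :
  t <= j -> key (j - t) (iter t par x) = key j x %/ #|T| ^ t.
Proof.
have T0 : 0 < #|T| by apply/card_gt0P; exists x.
elim: t => [|t IH] tj; first by rewrite subn0 divn1.
rewrite expnSr divnMA -IH; last by lia.
have -> : j - t = (j - t.+1).+1 by lia.
by rewrite /= divnMDl // divn_small // addn0.
Qed.

(** Division by [#|T| ^ t] is monotone, so the key of the middle ancestor is squeezed between two
    equal keys. *)
Lemma iter_par_between j t x y z : t <= j ->
  key j x <= key j y <= key j z ->
  iter t par x = iter t par z -> iter t par y = iter t par x.
Proof.
move=> tj /andP[xy yz] xz; apply: (@key_inj (j - t)).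
have := congr1 (key (j - t)) xz; rewrite !key_iter_par //.
move: (leq_div2r (#|T| ^ t) xy) (leq_div2r (#|T| ^ t) yz); lia.
Qed.

Lemma iter_par_eq_leq s t x y : s <= t ->
  iter s par x = iter s par y -> iter t par x = iter t par y.
Proof. by move=> st E; rewrite -(subnK st) !iterD E. Qed.

Lemma window_cycle j (x : nat -> T) a M : 0 < M <= j -> j <= l ->
  (forall q, q <= 2 * l + 1 - 2 * M -> d (x (a + q)) = j) ->
  {in gtn (2 * l + 2 - 2 * M) &, injective (fun q => x (a + q))} ->
  (forall q, q < 2 * l + 1 - 2 * M -> e (x (a + q)) (x (a + q).+1)) ->
  iter M par (x a) = iter M par (x (a + (2 * l + 1 - 2 * M))) ->
  iter M.-1 par (x a) <> iter M.-1 par (x (a + (2 * l + 1 - 2 * M))) ->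
  False.
Proof.
set D := 2 * l + 1 - 2 * M => Mj jl dx xinj xe eqM neqM; apply: no_cycle.
set u := x a; set w := x (a + D).
have du : d u = j by rewrite /u -[a]addn0 dx.
have dw : d w = j by rewrite dx.
(* The cycle follows the path from [u] to [w], climbs [M] levels to the common ancestor, then
   descends to the parent of [u]; the closing edge returns to [u]. Its length is [D + 2 * M]. *)
exists (fun q => if q < D then x (a + q) else
  if q <= D + M then iter (q - D) par w else iter (2 * l + 1 - q) par u).
have lt_neq t : t < M -> iter t par u <> iter t par w.
  by move=> tM E; apply: neqM; apply: iter_par_eq_leq E; lia.
split.
- suff inj q r : q < r -> r < (2 * l).+1 ->
    (if q < D then x (a + q) else
     if q <= D + M then iter (q - D) par w else iter (2 * l + 1 - q) par u) <>
    (if r < D then x (a + r) else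
     if r <= D + M then iter (r - D) par w else iter (2 * l + 1 - r) par u).
    move=> q r; rewrite !inE => qn rn E; case: (ltngtP q r) => // [qr|rq].
      by case: (inj _ _ qr rn).
    by case: (inj _ _ rq qn).
  move=> qr rn; have [qD|Dq] := ltnP q D; have [rD|Dr] := ltnP r D; try lia.
  + by move/xinj; rewrite !inE => H; have := H _ _; lia.
  + case: (leqP r (D + M)) => rDM.
      have [->|rneq] := eqVneq r D.
        by rewrite subnn /= /w => /xinj; rewrite !inE => H; have := H _ _; lia.
      by move/(congr1 d); rewrite dx ?iter_par_depth ?dw; lia.
    by move/(congr1 d); rewrite dx ?iter_par_depth ?du; lia.
  + case: (leqP r (D + M)) => rDM.
      rewrite ifT; last by lia.
      by move/(congr1 d); rewrite !iter_par_depth ?dw; lia.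
    case: (leqP q (D + M)) => qDM.
      move=> E; have := congr1 d E; rewrite !iter_par_depth ?du ?dw; try lia.
      move=> Et; apply: (@lt_neq (q - D)); first by lia.
      by rewrite E; congr (iter _ par u); lia.
    by move/(congr1 d); rewrite !iter_par_depth ?du; lia.
- move=> q qn; have [qD|Dq] := ltnP q D.
    have := xe q qD; rewrite -addnS; case: (ltnP q.+1 D) => // Dq.
    have -> : q.+1 = D by lia.
    by rewrite leq_addr subnn.
  rewrite [q.+1 < D]ltnNge leqW //=.
  case: (leqP q (D + M)) => qDM; case: (leqP q.+1 (D + M)) => qDM'; try lia.
  + rewrite (subSn Dq); apply: iter_par_edge; rewrite dw; lia.
  + have -> : q - D = M by lia.
    have -> : 2 * l + 1 - q.+1 = M.-1 by lia.
    rewrite -eqM e_sym; have := @iter_par_edge M.-1 u.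
    by rewrite prednK; [apply; rewrite du|]; lia.
  + rewrite e_sym; have -> : 2 * l + 1 - q = (2 * l + 1 - q.+1).+1 by lia.
    apply: iter_par_edge; rewrite du; lia.
- have D0 : 0 < D by lia.
  rewrite D0 addn0 -/u [2 * l < D]ltnNge (_ : D <= 2 * l) /=; last by lia.
  case: (leqP (2 * l) (D + M)) => lDM.
    have -> : 2 * l - D = M by lia.
    have M1 : M = 1 by lia.
    rewrite -eqM M1 e_sym; apply: (@iter_par_edge 0); rewrite du; lia.
  have -> : 2 * l + 1 - 2 * l = 1 by lia.
  rewrite e_sym; apply: (@iter_par_edge 0); rewrite du; lia.
Qed.

Definition up_edge j (x y : T) : bool :=
  [&& e x y, d x == j, d y == j & key j x < key j y].

Fixpoint up_walk j n (y : T) : bool :=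
  if n is n'.+1 then [exists x, up_edge j x y && up_walk j n' x] else true.

Lemma up_walk_vertices j n y : up_walk j n y ->
  exists x : nat -> T, x n = y /\ forall q, q < n -> up_edge j (x q) (x q.+1).
Proof.
elim: n y => [|n IH] y /=; first by exists (fun=> y).
case/existsP=> z /andP[zy /IH[x [xn xup]]].
exists (fun q => if q <= n then x q else y); rewrite ltnn.
split=> [//|q]; rewrite ltnS => qn; rewrite qn; case: (ltnP q n) => qn'; first exact: xup.
have -> : q = n by lia.
by rewrite xn.
Qed.

Lemma up_walk_short j y : j <= l -> ~~ up_walk j (2 * l).-1 y.
Proof.
move=> jl; apply/negP => /up_walk_vertices[x [_ xup]].
have xd q : q < 2 * l -> d (x q) = j.
  case: q => [|q] ql.
    by have /and4P[_ /eqP] : up_edge j (x 0) (x 1) by apply: xup; lia.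
  by have /and4P[_ _ /eqP] : up_edge j (x q) (x q.+1) by apply: xup; lia.
have xe q : q < (2 * l).-1 -> e (x q) (x q.+1) by case/xup/and4P.
have xlt q r : q < r -> r < 2 * l -> key j (x q) < key j (x r).
  elim: r => // r IH; rewrite ltnS leq_eqVlt => /orP[/eqP->|qr] rl.
    by have /and4P[] : up_edge j (x r) (x r.+1) by apply: xup; lia.
  have /and4P[_ _ _] : up_edge j (x r) (x r.+1) by apply: xup; lia.
  by apply: ltn_trans; apply: IH => //; lia.
have xle q r : q <= r -> r < 2 * l -> key j (x q) <= key j (x r).
  by rewrite leq_eqVlt => /orP[/eqP-> //|qr] rl; apply/ltnW/xlt.
have rooted q r : q < 2 * l -> r < 2 * l ->
    iter j par (x q) = iter j par (x r).
  by move=> ql rl; apply: root_uniq; rewrite iter_par_depth ?xd //; lia.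
pose joined t := [forall q : 'I_(2 * l).-1,
  iter t par (x q) == iter t par (x q.+1)].
have joinedj : joined j.
  by apply/forallP => q; apply/eqP/rooted; have := ltn_ord q; lia.
have [M joinedM Mmin] := ex_minnP (ex_intro joined j joinedj).
have Mj := Mmin _ joinedj.
have [p pl pM] : exists2 p, p < (2 * l).-1 &
    forall t, t < M -> iter t par (x p) <> iter t par (x p.+1).
  have [M0|M0] := posnP M; first by exists 0 => [|t]; lia.
  have: ~~ joined M.-1 by apply/negP => /Mmin; lia.
  rewrite negb_forall => /existsP[p /eqP pM]; exists (p : nat) => // t tM E.
  by apply: pM; apply: iter_par_eq_leq E; lia.
have M0 : 0 < M.
  rewrite lt0n; apply/eqP => M0.
  have /forallP/(_ (Ordinal pl))/eqP := joinedM.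
  rewrite M0 /= => E; have := xlt p p.+1; rewrite E ltnn => H.
  by have : false by apply: H; lia.
have Mall r q : q <= r -> r < 2 * l -> iter M par (x q) = iter M par (x r).
  elim: r => [|r IH]; first by case: q.
  rewrite leq_eqVlt => /orP[/eqP-> //|qr] rl.
  rewrite IH //; last by lia.
  have rl' : r < (2 * l).-1 by lia.
  by have /forallP/(_ (Ordinal rl'))/eqP := joinedM.
pose D := 2 * l + 1 - 2 * M.
(* The window of [D] edges must contain the pair [p], [p.+1] and end by index [2 * l - 1]; the
   latter means [a <= 2 * M - 2]. *)
pose a := minn p (2 * M - 2).
have ap : a <= p /\ p.+1 <= a + D /\ a + D < 2 * l by rewrite /a /D; lia.
apply: (@window_cycle j x a M); rewrite -/D ?M0 //.
- by move=> q qD; apply: xd; lia.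
- move=> q r; rewrite !inE => qD rD E; case: (ltngtP q r) => // H.
    have: key j (x (a + q)) < key j (x (a + r)) by apply: xlt; rewrite /D in ap; lia.
    by rewrite E ltnn.
  have: key j (x (a + r)) < key j (x (a + q)) by apply: xlt; rewrite /D in ap; lia.
  by rewrite E ltnn.
- by move=> q qD; apply: xe; lia.
- by apply: Mall; lia.
(* If the ends met at height [M.-1], all vertices of the window would have the same ancestor there,
   including the pair at [p]. *)
move=> E; apply: (pM M.-1); first by lia.
have Mj' : M.-1 <= j by lia.
by rewrite !(@iter_par_between j _ (x a) _ (x (a + D)) Mj' _ E) //;
  apply/andP; split; apply: xle; lia.
Qed.

Lemma layer_colouring j : j <= l -> exists f : T -> 'I_(2 * l).-1,
  forall x y, x != y -> d x = j -> d y = j -> e x y -> f x != f y.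
Proof.
(* The colour of [x] is the length of the longest increasing walk of layer [j] that ends at [x]. *)
move=> jl; pose f x := find (fun n => ~~ up_walk j n.+1 x) (iota 0 (2 * l).-1).
have f_lt x : f x < (2 * l).-1.
  rewrite -[X in _ < X](size_iota 0) -has_find; apply/hasP; exists (2 * l).-2.
    by rewrite mem_iota; lia.
  by rewrite prednK; [apply: up_walk_short|lia].
have f_up x y : up_edge j x y -> f x < f y.
  move=> xy; rewrite ltnNge; apply/negP => fyx.
  have: ~~ up_walk j (f y).+1 y.
    have := @nth_find _ 0 (fun n => ~~ up_walk j n.+1 y) (iota 0 (2 * l).-1).
    rewrite -/(f y) nth_iota //; apply.
    by rewrite has_find size_iota f_lt.
  case/negP; apply/existsP; exists x; rewrite xy /=.
  case E: (f y) => [//|n].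
  have := @before_find _ 0 (fun n => ~~ up_walk j n.+1 x) (iota 0 (2 * l).-1) n.
  rewrite -/(f x) nth_iota; last by have := f_lt y; lia.
  by rewrite add0n => H; apply: negbFE; apply: H; lia.
exists (fun x => Ordinal (f_lt x)) => x y xy dx dy exy.
rewrite -val_eqE /= neq_ltn; case: (ltngtP (key j x) (key j y)) => H.
- by rewrite f_up // /up_edge exy dx dy eqxx.
- by rewrite [X in _ || X]f_up ?orbT // /up_edge e_sym exy dx dy eqxx.
by rewrite (key_inj H) eqxx in xy.
Qed.

End Layers.

(** * Balls, breadth-first depth and the colouring of a ball *)

Section Balls.
Local Open Scope nat_scope.

Variables (T : finType) (e : rel T) (v : T).

Definition ball j : {set T} :=
  iter j (fun B : {set T} => B :|: [set y | [exists x in B, e x y]]) [set v].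

Lemma mem_ballS j y :
  (y \in ball j.+1) = (y \in ball j) || [exists x in ball j, e x y].
Proof. by rewrite /= !inE. Qed.

Lemma sub_ball i j : i <= j -> ball i \subset ball j.
Proof.
elim: j => [|j IH]; first by rewrite leqn0 => /eqP->.
rewrite leq_eqVlt => /orP[/eqP-> //|/IH ij].
exact: subset_trans ij (subsetUl _ _).
Qed.

Lemma ball_edge j x y : x \in ball j -> e x y -> y \in ball j.+1.
Proof.
by move=> xj xy; rewrite mem_ballS; apply/orP; right; apply/exists_inP; exists x.
Qed.

Variable l : nat.

(* Vertices outside [ball l] get the depth [l.+1]. *)
Definition depth x := find (fun j => x \in ball j) (iota 0 l.+1).

Lemma depth_leq j x : j <= l -> (depth x <= j) = (x \in ball j).
Proof.
move=> jl; apply/idP/idP => [xj|xj].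
  have hx : has (fun j => x \in ball j) (iota 0 l.+1).
    by rewrite has_find size_iota; apply: leq_ltn_trans xj _.
  have := nth_find 0 hx; rewrite -/(depth x) nth_iota; last by lia.
  exact: subsetP (sub_ball xj) _.
rewrite leqNgt; apply/negP => jx.
by have := before_find 0 jx; rewrite nth_iota ?xj.
Qed.

Lemma depth_edge x y : depth x <= l -> e x y -> depth y <= (depth x).+1.
Proof.
move=> xl xy; case: (ltnP (depth x) l) => xl'.
  by rewrite depth_leq //; apply: ball_edge xy; rewrite -depth_leq.
(* At depth [l] the bound is the default value [l.+1]. *)
by rewrite /depth (leq_trans (find_size _ _)) // size_iota.
Qed.

Definition parent x := odflt x [pick y in ball (depth x).-1 | e y x].

Lemma parentP x : 0 < depth x <= l ->
  e (parent x) x /\ depth (parent x) = (depth x).-1.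
Proof.
move=> xl; have x_in : x \in ball (depth x) by rewrite -depth_leq; lia.
have x_out : x \notin ball (depth x).-1 by rewrite -depth_leq; lia.
rewrite /parent; case: pickP => [y /andP[yb yx]|no] /=.
  split=> //; have yd : depth y <= (depth x).-1 by rewrite depth_leq; lia.
  have := @depth_edge y x _ yx; lia.
move: x_in; rewrite -[in ball _](@prednK (depth x)); last by lia.
rewrite mem_ballS (negPf x_out) => /exists_inP[y yb yx].
by have := no y; rewrite yb yx.
Qed.

Hypotheses (e_sym : symmetric e) (no_cycle : ~ has_cycle e (2 * l)).
Hypothesis l_gt0 : 0 < l.

(** Depths along an edge differ by at most one: parity separates consecutive layers, and the layer
    colouring handles edges inside a layer. *)
Lemma ball_colouring : exists f : T -> bool * 'I_(2 * l).-1,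
  forall x y, x != y -> x \in ball l -> y \in ball l -> e x y -> f x != f y.
Proof.
have root x y : depth x = 0 -> depth y = 0 -> x = y.
  have d0 z : depth z = 0 -> z = v.
    by move=> z0; apply/set1P; have := @depth_leq 0 z; rewrite z0 => <-.
  by move=> /d0-> /d0->.
have dpar x : 0 < depth x <= l -> depth (parent x) = (depth x).-1.
  by case/parentP.
have epar x : 0 < depth x <= l -> e x (parent x).
  by case/parentP; rewrite e_sym.
have layers (j : 'I_l.+1) := layer_colouring e_sym no_cycle l_gt0 root dpar epar
  (ltn_ord j : j <= l).
have [f Hf] := fin_all_exists layers.
exists (fun x => (odd (depth x), f (inord (depth x)) x)) => x y xy.
rewrite -!depth_leq // => xl yl exy; apply/eqP => -[Eodd Ef].
have dxy : depth x = depth y.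
  have := depth_edge xl exy; rewrite e_sym in exy; have := depth_edge yl exy.
  move: Eodd; lia.
rewrite dxy in Ef; have := Hf (inord (depth y)) x y xy.
by rewrite inordK // Ef eqxx => H; have := H dxy erefl exy.
Qed.

End Balls.

(** * Weighted averaging and growth of sequences *)

Section Weights.
Variable R : realFieldType.

Lemma pigeonhole_sum (C : finType) (P : {set C}) (F : C -> R) : P != set0 ->
  exists2 c, c \in P & \sum_(i in P) F i <= #|P|%:R * F c.
Proof.
case/set0Pn=> c0 c0P; case: (@arg_maxP _ R C c0 [in P] F c0P) => c cP cmax.
exists c => //; rewrite mulr_natl -sumr_const.
by apply: ler_sum => i /cmax.
Qed.

Lemma heavy_independent_subset (T : finType) (e : rel T) (v : T) (l : nat)
    (w : T -> R) (B : {set T}) :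
  symmetric e -> ~ has_cycle e (2 * l) -> (0 < l)%N -> B \subset ball e v l ->
  exists I : {set T}, [/\ I \subset B,
    {in I &, forall x y, x != y -> ~~ e x y} &
    \sum_(x in B) w x <= (4 * l - 2)%N%:R * \sum_(x in I) w x].
Proof.
move=> e_sym no_cycle l_gt0 Bl.
have [f Hf] := ball_colouring v e_sym no_cycle l_gt0.
have Cn0 : [set: bool * 'I_(2 * l).-1] != set0.
  have l0 : (0 < (2 * l).-1)%N by lia.
  by apply/set0Pn; exists (true, Ordinal l0); rewrite inE.
have [c _ Hc] := pigeonhole_sum (fun c => \sum_(x in B | f x == c) w x) Cn0.
exists [set x in B | f x == c]; split.
- by apply/subsetP => x; rewrite inE => /andP[].
- move=> x y; rewrite !inE => /andP[xB /eqP fx] /andP[yB /eqP fy] xy.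
  apply/negP => exy.
  have := Hf x y xy (subsetP Bl _ xB) (subsetP Bl _ yB) exy.
  by rewrite fx fy eqxx.
rewrite (partition_big f xpredT) //=.
rewrite cardsT card_prod card_bool card_ord in Hc.
have -> : (4 * l - 2 = 2 * (2 * l).-1)%N by lia.
rewrite [X in _ <= _ * X](eq_bigl (fun x => (x \in B) && (f x == c))).
  by apply: le_trans Hc; rewrite le_eqVlt; apply/orP; left; apply/eqP;
    apply: eq_bigl => i; rewrite inE.
by move=> x; rewrite inE.
Qed.

(** If [b j.+1 > c * b j] for all [0 < j < l], then [c * b l >= c ^+ l * b 1 >= M]. *)
Lemma slow_growth (b : nat -> R) (c M : R) (l : nat) : 0 < c -> (0 < l)%N ->
  M <= c ^+ l * b 1%N ->
  M <= c * b l \/ exists2 j, (0 < j < l)%N & b j.+1 <= c * b j.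
Proof.
move=> c0; elim: l b => // -[|l] IH b _ HM; first by left.
case: (lerP (b 2) (c * b 1%N)) => b2; first by right; exists 1%N.
have [//||H|[j jl Hj]] := IH (fun j => b j.+1).
- by apply: le_trans HM _; rewrite exprSr -mulrA ler_wpM2l ?exprn_ge0 // ltW.
- by left.
by right; exists j.+1 => //; lia.
Qed.

End Weights.

(** * The potential of active colours *)

Section Potential.

Variables (R : realFieldType) (T K : finType) (E : K -> rel T) (l : nat) (c : R).
Hypotheses (E_sym : forall i, symmetric (E i)).
Hypothesis no_cycle : forall i, ~ has_cycle (E i) (2 * l).
Hypothesis E_cover : forall x y, x != y -> exists i, E i x y.
Hypotheses (l_gt0 : (0 < l)%N) (c_gt0 : 0 < c) (c_exp : #|K|%:R <= c ^+ l).

Let chi : R := (4 * l - 2)%N%:R.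
Let q : R := (chi * c)^-1.

Let chi_gt0 : 0 < chi.
Proof. by rewrite ltr0n; lia. Qed.

Let q_gt0 : 0 < q.
Proof. by rewrite invr_gt0 mulr_gt0. Qed.

(* A colour [i] that is not in [A x] has no edge at [x] inside [W]. *)
Definition active_at_edges (A : T -> {set K}) (W : {set T}) :=
  forall x y i, x \in W -> y \in W -> x != y -> E i x y -> i \in A x.

Definition edge_in (W : {set T}) i : rel T :=
  fun x y => [&& x \in W, y \in W, x != y & E i x y].

Lemma edge_in_sym (W : {set T}) i : symmetric (edge_in W i).
Proof.
by move=> x y; rewrite /edge_in E_sym eq_sym andbCA.
Qed.

Lemma edge_in_no_cycle (W : {set T}) i : ~ has_cycle (edge_in W i) (2 * l).
Proof.
case=> g [ginj gE gE0]; apply: (@no_cycle i); exists g; split=> //.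
  by move=> r /gE /and4P[].
by case/and4P: gE0.
Qed.

Lemma ball_sub (W : {set T}) i v j : v \in W -> ball (edge_in W i) v j \subset W.
Proof.
move=> vW; elim: j => [|j IH]; first by rewrite sub1set.
rewrite subUset IH /=; apply/subsetP => y; rewrite inE => /exists_inP[x _].
by case/and4P.
Qed.

Lemma ball_active A (W : {set T}) i v j x : active_at_edges A W -> v \in W ->
  i \in A v -> x \in ball (edge_in W i) v j -> i \in A x.
Proof.
move=> AW vW iv; elim: j x => [|j IH] x; first by move=> /set1P->.
rewrite mem_ballS => /orP[/IH //|/exists_inP[y _]]; rewrite edge_in_sym.
by case/and4P=> xW yW xy; apply: AW.
Qed.

Lemma exists_slow_ball A (W : {set T}) v (w : T -> R) : (forall x, 0 <= w x) ->
  active_at_edges A W -> v \in W -> A v != set0 ->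
  exists i j (S : {set T}), let B := ball (edge_in W i) v j in
    [/\ i \in A v, (j <= l)%N, B \subset S, S \subset W &
      (forall x y, x \in B -> edge_in W i x y -> y \in S) /\
      \sum_(x in S) w x <= c * \sum_(x in B) w x].
Proof.
move=> w0 AW vW Av.
pose b i j := \sum_(x in ball (edge_in W i) v j) w x.
have [i iv Hi] := pigeonhole_sum (fun i => b i 1%N) Av.
have b1 : \sum_(x in W) w x <= c ^+ l * b i 1%N.
  have b1_ge0 : 0 <= b i 1%N by apply: sumr_ge0.
  apply: (@le_trans _ _ (#|A v|%:R * b i 1%N)); last first.
    apply: ler_wpM2r => //; apply: le_trans c_exp.
    by rewrite ler_nat max_card.
  apply: le_trans Hi; rewrite /b.
  (* Double counting: every vertex of [W] lies in a ball of radius 1 around [v] in some colour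
     active at [v]. *)
  under [X in _ <= X]eq_bigr do rewrite big_mkcond.
  rewrite exchange_big big_mkcond /=; apply: ler_sum => x _.
  case: ifP => xW; last by apply: sumr_ge0 => i' _; case: ifP.
  have [i' i'v xb] : exists2 i', i' \in A v & x \in ball (edge_in W i') v 1.
    have [->|vx] := eqVneq x v.
      by exists i => //; apply: subsetP (sub_ball _ _ (leq0n 1)) _ (set11 _).
    rewrite eq_sym in vx; have [i' Ei'] := E_cover vx.
    exists i'; first exact: AW Ei'.
    by apply: (@ball_edge _ _ v 0 v x (set11 v)); rewrite /edge_in vW xW vx.
  rewrite (bigD1 i') //= xb lerDl; apply: sumr_ge0 => i'' _.
  by case: ifP.
have [Wl|[j jl Hj]] := slow_growth c_gt0 l_gt0 b1.
  exists i, l, W; split=> //; first exact: ball_sub.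
  by split=> // x y _ /and4P[].
exists i, j, (ball (edge_in W i) v j.+1); split=> //; first by lia.
- exact: sub_ball.
- exact: ball_sub.
by split=> // x y; apply: ball_edge.
Qed.

(** Induction on the total number of active pairs of a vertex of [W] and a colour. *)
Lemma potential_le1 A (W : {set T}) : active_at_edges A W ->
  \sum_(x in W) q ^+ #|A x| <= 1.
Proof.
have [m] := ubnP (\sum_(x in W) #|A x|)%N.
elim: m A W => // m IH A W; rewrite ltnS => Wm AW.
have [v /andP[vW Av]|noA] := pickP [pred v in W | A v != set0]; last first.
  have A0 x : x \in W -> A x = set0.
    by move=> xW; apply/eqP; have := noA x; rewrite /= xW; case: eqP.
  rewrite (eq_bigr (fun=> 1)) => [|x xW]; last by rewrite A0 // cards0 expr0.
  rewrite sumr_const lern1; apply/card_le1P => x xW y; rewrite inE.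
  apply/idP/eqP => [yW|-> //]; apply/eqP; case: eqVneq => // yx.
  by have [i /(AW _ _ _ yW xW yx)] := E_cover yx; rewrite A0 // inE.
pose w x := q ^+ #|A x|.
have w0 x : 0 <= w x by rewrite exprn_ge0 // ltW.
have [i [j [S [iv jl BS SW [NS HS]]]]] := exists_slow_ball w0 AW vW Av.
set B := ball _ _ _ in BS NS HS.
have [I [IB Iind HI]] := heavy_independent_subset w
  (@edge_in_sym W i) (@edge_in_no_cycle W i) l_gt0 (sub_ball _ v jl).
rewrite -/B in IB HI.
have IS : I \subset S by apply: subset_trans IB BS.
have IW : I \subset W by apply: subset_trans IS SW.
have Iact x : x \in I -> i \in A x.
  by move/(subsetP IB); apply: ball_active.
(* Colour [i] may be deactivated on [I]: the [i]-neighbours of [I] in [W] lie in [S], and of [S]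
   only the [i]-independent set [I] is kept. *)
pose A' x := if x \in I then A x :\ i else A x.
pose W' := I :|: (W :\: S).
have W'W : W' \subset W by rewrite subUset IW subsetDl.
have splitW (V : nmodType) (F : T -> V) :
    \sum_(x in W) F x = \sum_(x in S) F x + \sum_(x in W :\: S) F x.
  by rewrite (big_setID S) /= (setIidPr SW).
have splitW' (V : nmodType) (F : T -> V) :
    \sum_(x in W') F x = \sum_(x in I) F x + \sum_(x in W :\: S) F x.
  rewrite -bigU /=; first by apply: eq_bigl => x; rewrite !inE.
  rewrite disjoint_subset.
  by apply/subsetP => x /(subsetP IS) xS; rewrite !inE xS.
have outI x : x \in W :\: S -> x \notin I.
  by rewrite inE => /andP[xS _]; apply: contra xS; apply: subsetP.
have active' : active_at_edges A' W'.
  move=> x y i' xW' yW' xy Exy.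
  have xW := subsetP W'W _ xW'; have yW := subsetP W'W _ yW'.
  have iA := AW _ _ _ xW yW xy Exy; rewrite /A'; case: ifP => // xI.
  rewrite !inE iA andbT; apply/eqP => ii; rewrite ii in Exy.
  have exy : edge_in W i x y by rewrite /edge_in xW yW xy.
  case/setUP: yW' => [yI|/setDP[_ /negP]].
    by have := Iind x y xI yI xy; rewrite exy.
  by apply; apply: NS exy; apply: subsetP xI.
have measure_lt : (\sum_(x in W') #|A' x| < \sum_(x in W) #|A x|)%N.
  rewrite (splitW nat) (splitW' nat) [X in (_ + X < _)%N](eq_bigr (fun x => #|A x|)).
    rewrite ltn_add2r [X in (_ < X)%N](big_setID I) /= (setIidPr IS).
    have Iv x : x \in I -> (#|A' x| < #|A x|)%N.
      by move=> xI; rewrite /A' xI (cardsD1 i (A x)) Iact.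
    have vS : v \in S by apply: subsetP BS _ (subsetP (sub_ball _ v (leq0n j)) _ (set11 v)).
    (* Strictness comes from [v]: inside [I] it loses the colour [i], outside [I] it is discarded
       with [A v] nonempty. *)
    have [vI|vI] := boolP (v \in I).
      apply: (leq_trans _ (leq_addr _ _)).
      rewrite (bigD1 v) //= [X in (_ < X)%N](bigD1 v) //= -addSn leq_add ?Iv //.
      by apply: leq_sum => x /andP[/Iv/ltnW].
    rewrite -addn1 leq_add //.
      by apply: leq_sum => x /Iv/ltnW.
    by rewrite (bigD1 v) ?inE ?vI //= addn_gt0 card_gt0 Av.
  by move=> x /outI xI; rewrite /A' (negPf xI).
apply: le_trans (IH A' W' (leq_trans measure_lt Wm) active').
rewrite splitW splitW' [X in _ <= _ + X](eq_bigr w); last first.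
  by move=> x /outI xI; rewrite /A' (negPf xI).
rewrite lerD2r; apply: le_trans HS _.
(* Losing a colour multiplies a weight by [q^-1 = chi * c], which pays for the factor [c] from [S]
   to [B] and [chi] from [B] to [I]. *)
rewrite [X in _ <= X](eq_bigr (fun x => q^-1 * w x)); last first.
  move=> x xI; rewrite /A' xI /w (cardsD1 i (A x)) Iact // exprS mulrA.
  by rewrite mulVf ?mul1r // gt_eqF.
rewrite -mulr_sumr invrK [chi * c]mulrC -mulrA.
by rewrite ler_wpM2l // ltW.
Qed.

End Potential.

(** * From the potential to Ramsey numbers *)

Lemma mono_copy_of_cycle n k (col : edge_colouring n k) i m :
  has_cycle (colour_class col i) m ->
  exists f : {ffun vertex (cycle_graph (m + 1)) -> 'I_n}, mono_copy col i f.
Proof.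
have col_sym : symmetric (colour_class col i).
  by move=> x y; rewrite /colour_class setUC.
case=> g [g_inj gE gE0]; exists [ffun x : 'I_(m + 1) => g x].
have gS (x : 'I_(m + 1)) : colour_class col i (g x) (g (ordS x)).
  have xm := ltn_ord x; case: (ltnP x m) => mx /=.
    by rewrite modn_small; [apply: gE | lia].
  have -> : (x = m :> nat)%N by lia.
  by rewrite -addn1 modnn.
apply/andP; split.
  apply/injectiveP => x y; rewrite !ffunE => gxy; apply/val_inj/g_inj => //;
    by rewrite inE -[X in (_ < X)%N]addn1 ltn_ord.
apply/forallP => x; apply/forallP => y; apply/implyP => /andP[_].
rewrite !ffunE => /orP[/eqP->|/eqP->]; first exact: gS.
by rewrite col_sym; apply: gS.
Qed.

Lemma not_arrows_leq (R : realFieldType) (k l n : nat) (c : R) :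
  (0 < l)%N -> 0 < c -> k%:R <= c ^+ l ->
  ~~ arrows k (cycle_graph (2 * l + 1)) n ->
  n%:R <= ((4 * l - 2)%N%:R * c) ^+ k.
Proof.
move=> l0 c0 kc; rewrite negb_forall => /existsP[col no_copy].
have E_sym i : symmetric (colour_class col i).
  by move=> x y; rewrite /colour_class setUC.
have no_cycle i : ~ has_cycle (colour_class col i) (2 * l).
  case/mono_copy_of_cycle => f Hf; case/negP: no_copy.
  by apply/existsP; exists i; apply/existsP; exists f.
have E_cover x y : x != y -> exists i, colour_class col i x y.
  move=> xy; have xy2 : #|[set x; y]| == 2 by rewrite cards2 xy.
  exists (col (Sub [set x; y] xy2)); apply/existsP; exists (Sub [set x; y] xy2).
  by rewrite SubK !eqxx.
have kc' : #|'I_k|%:R <= c ^+ l by rewrite card_ord.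
(* Initially all [k] colours are active at all [n] vertices. *)
have := @potential_le1 R _ _ _ l c E_sym no_cycle E_cover l0 c0 kc'
  (fun=> setT) setT.
rewrite sumr_const !cardsT !card_ord -[_ *+ n]mulr_natl exprVn => H.
have p0 : 0 < ((4 * l - 2)%N%:R * c) ^+ k.
  by rewrite exprn_gt0 // mulr_gt0 // ltr0n; lia.
by rewrite ler_pdivrMr // mul1r in H; apply: H => x y i; rewrite !inE.
Qed.

Theorem theorem1 (R : realType) (k l : nat) (hk : (0 < k)%N) (hl : (0 < l)%N) :
  (ramsey_number k (cycle_graph (2 * l + 1)%N))%:R
    <= (4 * l%:R - 2) ^+ k * (k%:R `^ (k%:R / l%:R)) + 1 :> R.
Proof.
have coef : 4 * l%:R - 2 = (4 * l - 2)%N%:R :> R.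
  by rewrite natrB ?natrM //; lia.
have c0 : 0 < k%:R `^ l%:R^-1 :> R by rewrite powR_gt0 // ltr0n.
have c_exp : (k%:R `^ l%:R^-1) ^+ l = k%:R :> R.
  by rewrite -powR_mulrn ?ltW // -powRrM mulVf ?powRr1 ?ler0n // pnatr_eq0; lia.
have -> : k%:R `^ (k%:R / l%:R) = (k%:R `^ l%:R^-1) ^+ k :> R.
  by rewrite -powR_mulrn ?ltW // -powRrM mulrC.
rewrite coef -exprMn /ramsey_number; case: ex_minnP => [[|n] _ n_min].
  by rewrite addr_ge0 // exprn_ge0 // mulr_ge0 // ltW.
(* The summand 1 arises because the bound applies to [n], one below the Ramsey number. *)
rewrite -natr1 lerD2r; apply: not_arrows_leq; rewrite ?c_exp //.
by apply/negP => /n_min; rewrite ltnn.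
Qed.
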